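(* Let $n\ge 2$ and let $\ell$ be a positive integer with $\ell\le n/2$, and let $\alpha>0$. Let $\mathbb{Q}^{(n,\ell,\alpha)}$ be the generator of the unlabelled exclusion process on the complete graph on $n$ vertices with parameters $\ell$ and $\alpha$. Then the eigenvalues of $-\mathbb{Q}^{(n,\ell,\alpha)}$ are $$0,\ \alpha n,\ 2\alpha(n-1),\ 3\alpha(n-2),\ \ldots,\ \ell\alpha(n-\ell+1)$$ with multiplicities $$1,\ n-1,\ \binom n2-n,\ \binom n3-\binom n2,\ \ldots,\ \binom n\ell-\binom n{\ell-1}$$ respectively. (That is, for $0\le i\le \ell$ the eigenvalue $i\alpha(n-i+1)$ has multiplicity $\binom ni-\binom n{i-1}$, with $\binom n{-1}=0$.)
   Context: Let $V$ be the vertex set of the complete graph on $n$ vertices and let $\binom V\ell$ denote the set of $\ell$-element subsets of $V$. The unlabelled exclusion process (UEP) with parameter $\ell$ (a positive integer, $\ell\le n/2$) and intensity $\alpha>0$ is the continuous time Markov process on $\binom V\ell$ with generator $\mathbb{Q}^{(n,\ell,\alpha)}=[q_{J,J'}]_{J,J'\in\binom V\ell}$ given by $q_{J,J}=-\alpha\ell(n-\ell)$, $q_{J,J'}=\alpha$ if $|J\,\Delta\,J'|=2$ (symmetric difference), and $q_{J,J'}=0$ otherwise. *)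

(* Defs.v *)
From HB Require Import structures.
From mathcomp Require Import all_boot all_order all_algebra.
From mathcomp Require Import reals.

Set Implicit Arguments.
Unset Strict Implicit.
Unset Printing Implicit Defensive.

Import Order.TTheory GRing.Theory Num.Theory.
Local Open Scope ring_scope.

Definition lsubsets (V : finType) (l : nat) : {set {set V}} :=
  [set J : {set V} | (#|J| == l)%N].

Definition symdiff (V : finType) (J J' : {set V}) : {set V} :=
  (J :\: J') :|: (J' :\: J).

Definition uep_rate (R : realType) (V : finType) (l : nat) (alpha : R)
    (J J' : {set V}) : R :=
  if J == J' then - (alpha * l%:R * (#|V|%:R - l%:R))
  else if (#|symdiff J J'| == 2)%N then alpha
  else 0.

(* The row and column indices are the l-subsets of V, through the library's
   enumeration enum_val : 'I_#|A| -> T of a finite set A. *)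
Definition uep_generator (R : realType) (V : finType) (l : nat) (alpha : R) :
    'M[R]_#|lsubsets V l| :=
  \matrix_(i, j) uep_rate l alpha (enum_val i) (enum_val j).

Definition uep_eigenvalue (R : realType) (n : nat) (alpha : R) (i : nat) : R :=
  i%:R * alpha * (n%:R - i%:R + 1).

(* The case split encodes the convention 'C(n, -1) = 0.  The subtraction on nat
   is not truncated when i <= n / 2. *)
Definition uep_multiplicity (n i : nat) : nat :=
  ('C(n, i) - (if i is j.+1 then 'C(n, j) else 0))%N.

(* Main.v *)
Require Import Defs.
From HB Require Import structures.
From mathcomp Require Import all_boot all_order all_algebra.
From mathcomp Require Import reals.
From mathcomp Require Import zify ring.

Set Implicit Arguments.
Unset Strict Implicit.
Unset Printing Implicit Defensive.

Import Order.TTheory GRing.Theory Num.Theory.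
Local Open Scope ring_scope.

(** Write n for the number of vertices, M_k for minus the generator on
    k-subsets, lambda_k for alpha k (n - k + 1), and U_k for the 0-1 matrix of
    inclusion between k-subsets and (k+1)-subsets. Counting the (k+1)-subsets
    above, or the k-subsets below, two given sets shows that both U_k U_k^T and
    U_k^T U_k are a multiple of the identity plus the adjacency relation
    |J Delta J'| = 2, and the constants are such that with the same scalar
      M_k     = lambda_(k+1) - alpha U_k U_k^T  ([uep_generator_up]),
      M_(k+1) = lambda_(k+1) - alpha U_k^T U_k  ([uep_generator_down]).
    Now A B and B A have the same spectrum except for the eigenvalue 0, so
    passing from M_k to M_(k+1) keeps all eigenvalues with their
    multiplicities, and only adds lambda_(k+1) as many times as the size grows,
    which is 'C(n, k+1) - 'C(n, k) when 2 (k+1) <= n. Since M_0 = 0 is a 1 x 1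
    matrix, the spectrum follows by induction on k.

    The step from A B to B A is carried out for characteristic polynomials
    ([char_poly_scalar_sub_mulmxC]) and for dimensions of eigenspaces
    ([rank_eigenspace_scalar_sub_mulmxC] away from the new eigenvalue,
    [rank_eigenspace_scalar_sub_mulmx] at it). The values lambda_i with
    2 i <= n are pairwise distinct ([uep_eigenvalue_inj]), which makes
    lambda_(k+1) a new eigenvalue and lets the multiplicities be read off the
    factored characteristic polynomial. *)

(** * Spectra of A B and B A *)

(** Both sides are x^p times the determinant of the block matrix with rows
    (x, -A) and (B, 1): its lower left block is cleared by column operations, or
    by row operations after scaling the last p rows by x. *)
Lemma det_scalar_add_mulmxC (R : comNzRingType) (m p : nat) (x : R)
    (A : 'M[R]_(m, p)) (B : 'M[R]_(p, m)) :
  x ^+ p * \det (x%:M + A *m B) = x ^+ m * \det (x%:M + B *m A).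
Proof.
pose P := block_mx x%:M (- A) B 1%:M.
have <- : \det P = \det (x%:M + A *m B).
  have : P *m block_mx 1%:M 0 (- B) 1%:M
         = block_mx (x%:M + A *m B) (- A) 0 1%:M.
    rewrite mulmx_block !mulmx1 !mulmx0 !add0r !mulmxN !mulNmx opprK.
    by rewrite mul1mx addrN.
  move/(congr1 determinant).
  by rewrite det_mulmx det_lblock det_ublock !det1 !mulr1.
have : block_mx 1%:M 0 (- B) x%:M *m P
       = block_mx x%:M (- A) 0 (x%:M + B *m A).
  rewrite mulmx_block !mul1mx !mul0mx !addr0 !mulmxN !mulNmx opprK mulmx1.
  by rewrite mul_mx_scalar mul_scalar_mx addNr addrC.
move/(congr1 determinant).
by rewrite det_mulmx det_lblock det_ublock det1 mul1r !det_scalar.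
Qed.

(** Sylvester's identity over polynomials, with x = X - c; the common factor
    x^m cancels because m <= p. *)
Lemma char_poly_scalar_sub_mulmxC (F : fieldType) (m p : nat) (c : F)
    (A : 'M[F]_(m, p)) (B : 'M[F]_(p, m)) :
  (m <= p)%N ->
  char_poly (c%:M - B *m A)
  = char_poly (c%:M - A *m B) * ('X - c%:P) ^+ (p - m).
Proof.
move=> le_mp.
have cpE k q (C : 'M[F]_(k, q)) (D : 'M[F]_(q, k)) :
    char_poly_mx (c%:M - C *m D)
    = ('X - c%:P)%:M + map_mx polyC C *m map_mx polyC D.
  rewrite /char_poly_mx map_mxB map_scalar_mx map_mxM /=.
  by rewrite opprB raddfB /= addrA addrAC.
have nz : ('X - c%:P) ^+ m != 0 by rewrite expf_neq0 ?polyXsubC_eq0.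
apply: (mulfI nz); rewrite /char_poly !cpE -det_scalar_add_mulmxC.
by rewrite mulrCA -exprD subnKC // mulrC.
Qed.

(** Right multiplication by A sends one eigenspace into the other; it is
    injective there, because following it by B is multiplication by the nonzero
    scalar c - a. *)
Lemma rank_eigenspace_scalar_sub_mulmxC (F : fieldType) (m p : nat) (c a : F)
    (A : 'M[F]_(m, p)) (B : 'M[F]_(p, m)) :
  a != c ->
  \rank (eigenspace (c%:M - A *m B) a) = \rank (eigenspace (c%:M - B *m A) a).
Proof.
move=> neq_ac.
suff le k q (C : 'M[F]_(k, q)) (D : 'M[F]_(q, k)) :
    (\rank (eigenspace (c%:M - C *m D) a)
     <= \rank (eigenspace (c%:M - D *m C) a))%N.
  by apply/eqP; rewrite eqn_leq !le.
set E := eigenspace _ a.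
have : E *m (c%:M - C *m D) = a *: E by apply/eigenspaceP.
rewrite mulmxBr mul_mx_scalar => /eqP.
rewrite subr_eq addrC -subr_eq -scalerBl => /eqP ECD.
have nz : c - a != 0 by rewrite subr_eq0 eq_sym.
have -> : \rank E = \rank (E *m C).
  apply/eqP; rewrite eqn_leq mxrankM_maxl andbT.
  by rewrite -(mxrank_scale_nz E nz) ECD mulmxA mxrankM_maxl.
apply: mxrankS; apply/eigenspaceP.
rewrite mulmxBr mul_mx_scalar mulmxA -(mulmxA E) -ECD -scalemxAl.
by rewrite -scalerBl opprB addrCA subrr addr0.
Qed.

(** The hypothesis says that A B is invertible. Hence so is its square
    A (B A) B, which forces B A to have rank m; the eigenspace is the kernel of
    B A. *)
Lemma rank_eigenspace_scalar_sub_mulmx (F : fieldType) (m p : nat) (c : F)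
    (A : 'M[F]_(m, p)) (B : 'M[F]_(p, m)) :
  ~~ eigenvalue (c%:M - A *m B) c ->
  \rank (eigenspace (c%:M - B *m A) c) = (p - m)%N.
Proof.
have eigE k q (C : 'M[F]_(k, q)) (D : 'M[F]_(q, k)) :
    eigenspace (c%:M - C *m D) c = kermx (- (C *m D)).
  by rewrite /eigenspace addrAC subrr add0r.
rewrite /eigenvalue !eigE negbK -mxrank_eq0 mxrank_ker mxrank_ker !mxrank_opp.
rewrite subn_eq0 => le_m.
have rAB : \rank (A *m B) = m by apply/eqP; rewrite eqn_leq rank_leq_row.
suff -> : \rank (B *m A) = m by [].
apply/eqP; rewrite eqn_leq (leq_trans (mxrankM_maxr _ _) (rank_leq_row _)) /=.
have free : row_free (A *m B) by rewrite /row_free rAB.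
(* m is the rank of (A B)^2 = A (B A) B, a product with factor B A. *)
have := mxrankMfree (A *m B) free; rewrite rAB => {1}<-.
by rewrite -mulmxA (leq_trans (mxrankM_maxr _ _)) // mulmxA mxrankM_maxl.
Qed.

(** * Inclusion matrices and the generator *)

(** Complementation turns supersets of A into subsets of its complement; both
    sides vanish when |A| > m. *)
Lemma card_supersets (V : finType) (A : {set V}) (m : nat) :
  (m <= #|V|)%N ->
  #|[set T : {set V} | A \subset T & #|T| == m]|
  = 'C(#|V| - #|A|, #|V| - m).
Proof.
move=> le_mn; have := cardsCs (~: A); rewrite setCK => <-.
rewrite -cards_draws.
rewrite -(card_imset _ (can_inj (@setCK V))); apply: eq_card => T.
apply/imsetP/idP => [[S] | ].
  rewrite !inE => /andP[sAS /eqP cS] ->.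
  by rewrite setCS sAS cardsCs setCK cS /=.
rewrite inE => /andP[sTA /eqP cT]; exists (~: T); last by rewrite setCK.
by rewrite inE -setCS setCK sTA cardsCs setCK cT subKn /=.
Qed.

(** For sets of equal size, |J Delta J'| = 2 |J \ J'|, so that the rate depends
    on |J \ J'| only, as do the sizes of the union and the intersection. *)
Lemma uep_rateE (R : realType) (V : finType) (k : nat) (alpha : R)
    (J J' : {set V}) :
  #|J| = k -> #|J'| = k ->
  uep_rate k alpha J J' =
    match #|J :\: J'| with
    | 0 => - (alpha * k%:R * (#|V|%:R - k%:R))
    | 1 => alpha
    | _ => 0
    end.
Proof.
move=> cJ cJ'.
have cD : #|J' :\: J| = #|J :\: J'|.
  by rewrite !cardsD setIC cJ cJ'.
have cS : #|symdiff J J'| = (#|J :\: J'|).*2.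
  rewrite /symdiff cardsU cD addnn -[RHS]subn0; congr (_ - _)%N.
  by apply/eqP; rewrite cards_eq0; apply/eqP/setP=> x; rewrite !inE;
    do 2!case: (x \in _).
have eqJ : (J == J') = (#|J :\: J'| == 0)%N.
  by rewrite cards_eq0 setD_eq0 eqEcard cJ cJ' leqnn andbT.
by rewrite /uep_rate eqJ cS; case: #|_| => [|[|t]].
Qed.

Definition inclusion_mx (R : nzSemiRingType) (V : finType) (k m : nat) :
    'M[R]_(#|lsubsets V k|, #|lsubsets V m|) :=
  \matrix_(i < #|lsubsets V k|, j < #|lsubsets V m|)
    (enum_val i \subset enum_val j)%:R.

Lemma card_enum_val_lsubsets (V : finType) (k : nat) (i : 'I_#|lsubsets V k|) :
  #|enum_val i| = k.
Proof. by have := enum_valP i; rewrite inE => /eqP. Qed.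

Lemma card_lsubsets (V : finType) (k : nat) : #|lsubsets V k| = 'C(#|V|, k).
Proof.
by rewrite -cardsT -cards_draws; apply: eq_card => J; rewrite !inE subsetT.
Qed.

Lemma sum_lsubsets_indicator (R : nzSemiRingType) (V : finType) (k : nat)
    (P : pred {set V}) :
  \sum_(t < #|lsubsets V k|) (P (enum_val t))%:R
  = #|[set T | P T & #|T| == k]|%:R :> R.
Proof.
rewrite -(big_enum_val (fun T => (P T)%:R)) /=.
rewrite -[in RHS]sum1_card natr_sum.
rewrite [RHS](eq_bigl (fun T => (T \in lsubsets V k) && P T)); last first.
  by move=> T; rewrite !inE andbC.
by rewrite big_mkcondr /=; apply: eq_bigr => T _; case: (P T).
Qed.

Lemma inclusion_mx_mul_tr (R : nzSemiRingType) (V : finType) (k m : nat)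
    (i j : 'I_#|lsubsets V k|) :
  (m <= #|V|)%N ->
  (inclusion_mx R V k m *m (inclusion_mx R V k m)^T) i j
  = 'C(#|V| - #|enum_val i :|: enum_val j|, #|V| - m)%:R.
Proof.
move=> le_mn; rewrite mxE -card_supersets // -sum_lsubsets_indicator.
by apply: eq_bigr => t _; rewrite !mxE -natrM mulnb -subUset.
Qed.

Lemma inclusion_mx_tr_mul (R : nzSemiRingType) (V : finType) (k m : nat)
    (i j : 'I_#|lsubsets V m|) :
  ((inclusion_mx R V k m)^T *m inclusion_mx R V k m) i j
  = 'C(#|enum_val i :&: enum_val j|, k)%:R.
Proof.
rewrite mxE -cards_draws -sum_lsubsets_indicator.
by apply: eq_bigr => t _; rewrite !mxE -natrM mulnb -subsetI.
Qed.

(** On the diagonal, k (n - k) + (n - k) = (k + 1) (n - k). Off it, two k-sets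
    have a common superset of size k + 1 iff they differ in one element, and it
    is then their union. *)
Lemma uep_generator_up (R : realType) (V : finType) (k : nat) (alpha : R) :
  (k < #|V|)%N ->
  - uep_generator V k alpha
  = (uep_eigenvalue #|V| alpha k.+1)%:M
    - (alpha *: inclusion_mx R V k k.+1) *m (inclusion_mx R V k k.+1)^T.
Proof.
move=> lt_kn; apply/matrixP => i j.
rewrite -scalemxAl; have := inclusion_mx_mul_tr R i j lt_kn.
move: (_ *m _) => P PE; rewrite !mxE {P}PE.
set S := enum_val i; set T := enum_val j.
have cS : #|S| = k by apply: card_enum_val_lsubsets.
have cT : #|T| = k by apply: card_enum_val_lsubsets.
rewrite (uep_rateE _ cS cT).
have -> : (i == j) = (#|S :\: T| == 0)%N.
  rewrite -(inj_eq enum_val_inj) cards_eq0 setD_eq0.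
  by rewrite eqEcard cS cT leqnn andbT.
have cU : #|S :|: T| = (k + #|S :\: T|)%N.
  by rewrite cardsU cardsD cS cT; have := subset_leq_card (subsetIl S T); lia.
have := max_card (S :|: T); rewrite cU.
(* d is the number of points outside a (k+1)-set. *)
have [d ->] : exists d, #|V| = (k + d.+1)%N by exists (#|V| - k.+1)%N; lia.
have -> : (k + d.+1 - k.+1 = d)%N by lia.
rewrite /uep_eigenvalue; case: #|S :\: T| => [|[|t]] /= le_Un.
- have -> : (k + d.+1 - (k + 0) = d.+1)%N by lia.
  rewrite binSn natrD -[k.+1]addn1 -[d.+1]addn1 !natrD; ring.
- have -> : (k + d.+1 - (k + 1) = d)%N by lia.
  by rewrite binn mulr0n mulr1 add0r.
- by rewrite bin_small ?mulr0 ?mulr0n ?subr0 ?oppr0 //; lia.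
Qed.

(** On the diagonal, (k + 1) (n - k - 1) + (k + 1) = (k + 1) (n - k): the scalar
    is the same as for k-subsets. Off it, two (k+1)-sets have a common subset
    of size k iff they differ in one element. *)
Lemma uep_generator_down (R : realType) (V : finType) (k : nat) (alpha : R) :
  (k < #|V|)%N ->
  - uep_generator V k.+1 alpha
  = (uep_eigenvalue #|V| alpha k.+1)%:M
    - (inclusion_mx R V k k.+1)^T *m (alpha *: inclusion_mx R V k k.+1).
Proof.
move=> lt_kn; apply/matrixP => i j.
rewrite -scalemxAr; have := inclusion_mx_tr_mul R k i j.
move: (_ *m _) => P PE; rewrite !mxE {P}PE.
set S := enum_val i; set T := enum_val j.
have cS : #|S| = k.+1 by apply: card_enum_val_lsubsets.
have cT : #|T| = k.+1 by apply: card_enum_val_lsubsets.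
rewrite (uep_rateE _ cS cT).
have -> : (i == j) = (#|S :\: T| == 0)%N.
  rewrite -(inj_eq enum_val_inj) cards_eq0 setD_eq0.
  by rewrite eqEcard cS cT leqnn andbT.
have -> : #|S :&: T| = (k.+1 - #|S :\: T|)%N.
  by rewrite cardsD cS; have := subset_leq_card (subsetIl S T); lia.
have := subset_leq_card (subsetDl S T); rewrite cS.
rewrite /uep_eigenvalue; case: #|S :\: T| => [|[|t]] /= le_Dk.
- rewrite subn0 binSn -[k.+1]addn1 !natrD; ring.
- by rewrite subn1 binn mulr0n mulr1 add0r.
- by rewrite bin_small ?mulr0 ?mulr0n ?subr0 ?oppr0 //; lia.
Qed.

(** * The spectrum *)

(** The difference of the two values is alpha (i - j) (n + 1 - i - j), where
    i + j <= n makes the last factor positive. *)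
Lemma uep_eigenvalue_inj (R : realType) (n : nat) (alpha : R) (i j : nat) :
  0 < alpha -> (2 * i <= n)%N -> (2 * j <= n)%N ->
  uep_eigenvalue n alpha i = uep_eigenvalue n alpha j -> i = j.
Proof.
move=> alpha_gt0; rewrite /uep_eigenvalue => hi hj /eqP.
rewrite -subr_eq0.
have -> : i%:R * alpha * (n%:R - i%:R + 1) - j%:R * alpha * (n%:R - j%:R + 1)
          = alpha * ((i%:R - j%:R) * (n%:R + 1 - i%:R - j%:R)) by ring.
rewrite !mulf_eq0 gt_eqF //= => /orP[].
  by rewrite subr_eq0 eqr_nat => /eqP.
have -> : n%:R + 1 - i%:R - j%:R = (n + 1 - i - j)%:R :> R.
  by rewrite !natrB ?natrD //; lia.
rewrite pnatr_eq0; lia.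
Qed.

Lemma ltn_bin_half (n k : nat) :
  (2 * k.+1 <= n)%N -> ('C(n, k) < 'C(n, k.+1))%N.
Proof.
move=> le_kn; have := mul_bin_left n k.
have : (0 < 'C(n, k))%N by rewrite bin_gt0; lia.
nia.
Qed.

(** Without this a factor of the characteristic polynomial could be trivial and
    its root fail to be an eigenvalue. *)
Lemma uep_multiplicity_gt0 (n i : nat) :
  (2 * i <= n)%N -> (0 < uep_multiplicity n i)%N.
Proof.
case: i => [|i] le_in; rewrite /uep_multiplicity ?bin0 // subn_gt0.
exact: ltn_bin_half.
Qed.

Lemma uep_generator0 (R : realType) (V : finType) (alpha : R) :
  uep_generator V 0 alpha = 0.
Proof.
apply/matrixP => i j; rewrite !mxE.
rewrite uep_rateE ?card_enum_val_lsubsets // cardsD card_enum_val_lsubsets.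
by rewrite sub0n mulr0 mul0r oppr0.
Qed.

Lemma char_poly_uep (R : realType) (V : finType) (k : nat) (alpha : R) :
  (2 * k <= #|V|)%N ->
  char_poly (- uep_generator V k alpha)
  = \prod_(i < k.+1) ('X - (uep_eigenvalue #|V| alpha i)%:P)
                       ^+ uep_multiplicity #|V| i.
Proof.
elim: k => [_|k IHk le_kn].
  rewrite big_ord_recr big_ord0 /= mul1r /uep_eigenvalue !mul0r.
  rewrite uep_generator0 oppr0.
  have -> : char_poly (0 : 'M[R]_#|lsubsets V 0|)
            = ('X - 0%:P) ^+ #|lsubsets V 0|.
    by rewrite /char_poly /char_poly_mx map_mx0 !subr0 det_scalar.
  by rewrite card_lsubsets /uep_multiplicity subn0.
have lt_kn : (k < #|V|)%N by lia.
rewrite big_ord_recr /= -IHk; last by lia.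
rewrite uep_generator_down // uep_generator_up //.
rewrite char_poly_scalar_sub_mulmxC; last first.
  by rewrite !card_lsubsets ltnW // ltn_bin_half.
by congr (_ * _ ^+ _); rewrite !card_lsubsets.
Qed.

Lemma eigenvalue_uepP (R : realType) (V : finType) (k : nat) (alpha a : R) :
  (2 * k <= #|V|)%N ->
  eigenvalue (- uep_generator V k alpha) a
  <-> exists2 i : nat, (i <= k)%N & a = uep_eigenvalue #|V| alpha i.
Proof.
move=> le_kn; rewrite eigenvalue_root_char char_poly_uep // rootE horner_prod.
have rootXn i : (('X - (uep_eigenvalue #|V| alpha i)%:P)
                   ^+ uep_multiplicity #|V| i).[a] == 0
                = (0 < uep_multiplicity #|V| i)%N
                  && (a == uep_eigenvalue #|V| alpha i).
  by rewrite horner_exp hornerXsubC expf_eq0 subr_eq0.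
split=> [/prodf_eq0[i _] | [i le_ik a_eq]].
  by rewrite rootXn => /andP[_ /eqP ->]; exists i; rewrite // -ltnS.
apply/prodf_eq0; exists (Ordinal (le_ik : (i < k.+1)%N)) => //=.
by rewrite rootXn a_eq eqxx uep_multiplicity_gt0 //; lia.
Qed.

Lemma mup_char_poly_uep (R : realType) (V : finType) (k i : nat) (alpha : R) :
  0 < alpha -> (2 * k <= #|V|)%N -> (i <= k)%N ->
  mup (uep_eigenvalue #|V| alpha i) (char_poly (- uep_generator V k alpha))
  = uep_multiplicity #|V| i.
Proof.
move=> alpha_gt0 le_kn le_ik; rewrite char_poly_uep //.
rewrite (bigD1 (Ordinal (le_ik : (i < k.+1)%N))) //= mupMl.
  by rewrite mup_XsubCX eqxx.
rewrite rootE horner_prod; apply/prodf_neq0 => -[j lt_jk] /= neq_ji.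
rewrite horner_exp hornerXsubC expf_neq0 // subr_eq0.
apply: contraNneq neq_ji => /(uep_eigenvalue_inj alpha_gt0) eq_ij.
by apply/eqP/val_inj => /=; rewrite eq_ij // (leq_trans _ le_kn) //; lia.
Qed.

(** In the induction step, the eigenvalues lambda_i with i <= k are carried
    over from k-subsets, while lambda_(k+1) is not an eigenvalue there and so
    its eigenspace has exactly the growth in size as dimension. *)
Lemma rank_eigenspace_uep (R : realType) (V : finType) (k i : nat) (alpha : R) :
  0 < alpha -> (2 * k <= #|V|)%N -> (i <= k)%N ->
  \rank (eigenspace (- uep_generator V k alpha) (uep_eigenvalue #|V| alpha i))
  = uep_multiplicity #|V| i.
Proof.
move=> alpha_gt0; elim: k => [_|k IHk le_kn].
  rewrite leqn0 => /eqP ->.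
  rewrite uep_generator0 oppr0.
  rewrite /eigenspace /uep_eigenvalue !mul0r raddf0 subr0 mxrank_ker mxrank0.
  by rewrite card_lsubsets.
have lt_kn : (k < #|V|)%N by lia.
rewrite leq_eqVlt uep_generator_down // => /orP[/eqP -> | lt_ik].
  rewrite rank_eigenspace_scalar_sub_mulmx ?card_lsubsets //.
  rewrite -uep_generator_up //; apply/negP.
  rewrite eigenvalue_uepP; last by lia.
  by case=> j le_jk /(uep_eigenvalue_inj alpha_gt0) eq_kj; lia.
rewrite -rank_eigenspace_scalar_sub_mulmxC.
  by rewrite -uep_generator_up // IHk //; lia.
by apply/eqP => /(uep_eigenvalue_inj alpha_gt0) eq_ik; lia.
Qed.

Theorem theorem1p1 (R : realType) (n : nat) (V : finType) (l : nat) (alpha : R)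
    (hn : (2 <= n)%N) (hV : #|V| = n)
    (hl0 : (0 < l)%N) (hl : (2 * l <= n)%N) (halpha : 0 < alpha) :
  let M := - uep_generator V l alpha in
  (forall a : R,
     eigenvalue M a <->
     exists2 i : nat, (i <= l)%N & a = uep_eigenvalue n alpha i) /\
  (forall i : nat, (i <= l)%N ->
     mup (uep_eigenvalue n alpha i) (char_poly M) = uep_multiplicity n i /\
     \rank (eigenspace M (uep_eigenvalue n alpha i)) = uep_multiplicity n i).
Proof.
subst n; split=> [a | i le_il]; first exact: eigenvalue_uepP.
by rewrite mup_char_poly_uep // rank_eigenspace_uep.
Qed.
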